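(* Let $n\ge 2$, let $m_1,\dots,m_n>0$, and let $q_1,\dots,q_n:\mathbb{R}\to\mathbb{R}^N$ be an equally spaced choreographic solution of $$\ddot q_k=\sum_{j=1,\,j\neq k}^{n} m_j (q_j-q_k)\, f\!\left(\|q_j-q_k\|^2\right),\qquad k\in\{1,\dots,n\},$$ where $\|\cdot\|$ is the Euclidean norm and $f:\mathbb{R}_{>0}\to\mathbb{R}_{>0}$ is a positive function such that $\sqrt{x}\,f(x)$ is decreasing. If $d=n-1$, or $d=n-2$, or ($n$ is odd and $d=n-3$), then $m_1=m_2=\dots=m_n$. If $n$ is even and $d=n-3$, then all masses with an odd label are equal and all masses with an even label are equal.
   Context: A choreographic solution (choreography) is a solution $q_1,\dots,q_n$ for which there exist a twice continuously differentiable periodic function $p:\mathbb{R}\to\mathbb{R}^N$, with period $\widehat P$, and constants $h_1,\dots,h_n$ such that $q_k(t)=p(t+h_k)$ for all $k$ and $t$. It is equally spaced if $h_{k+1}-h_k$ is independent of $k$ (indices taken with $h_{k+n}=h_k+\widehat P$). The statement ''$d=k$'' means: there is a set $S\subset[0,\widehat P]$ of Lebesgue measure $\widehat P$ such that for every $t\in S$ the point masses $q_1(t),\dots,q_n(t)$ span a $k$-dimensional space (i.e. the difference vectors $q_j(t)-q_1(t)$, $j=2,\dots,n$, span a $k$-dimensional subspace). *)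

(* Defs.v *)
From HB Require Import structures.
From mathcomp Require Import all_boot all_order all_algebra.
From mathcomp Require Import all_classical all_reals all_analysis.
Set Implicit Arguments. Unset Strict Implicit. Unset Printing Implicit Defensive.
Import Order.TTheory GRing.Theory Num.Theory.
Import numFieldNormedType.Exports.
Local Open Scope classical_set_scope.
Local Open Scope ring_scope.

Definition sqnorm (R : realType) (N : nat) (v : 'rV[R]_N) : R :=
  \sum_(i < N) (v ord0 i) ^+ 2.

Definition span_dim (R : realType) (N : nat) (n : nat) : ('I_n -> 'rV[R]_N) -> nat :=
  match n return ('I_n -> 'rV[R]_N) -> nat with
  | 0 => fun _ => 0%N
  | n'.+1 => fun x => \rank (\matrix_(j < n'.+1) (x j - x ord0))
  end.

Definition dim_is (R : realType) (N n : nat) (q : 'I_n -> R -> 'rV[R]_N)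
    (P : R) (k : nat) : Prop :=
  exists S : set R,
    [/\ measurable S, S `<=` `[0, P],
        (@lebesgue_measure R S = P%:E)%E &
        forall t, S t -> span_dim (fun j => q j t) = k].

(* Main.v *)
(* Shifting time by the common spacing turns the equations of motion into the same equations for the cyclically shifted masses, with the same positions, so the mass differences mu_j = m_j - m_(j-1) exert no net force on any body. The total m-weighted position is constant, by periodicity, hence mu is also an affine dependency of the positions x_j.

At a fixed time let D be the space of affine dependencies, of dimension n - 1 - d. For such a mu and every l, the row with entries mu_j f(|x_j - x_l|^2) for j <> l, completed at l to have sum 0, lies in D. If for all l in its support this row is a multiple of mu, then f, hence the distance, is the same for all pairs in the support: a regular simplex has no nontrivial affine dependency, so mu = 0. This settles dim D <= 1. If dim D = 2, apply it to the combination of mu and its shift that vanishes at some j0 with mu_j0 <> 0: the elements of D vanishing at j0 form a line. So the shift of mu is c * mu, with c = 1 or c = -1 by comparing norms, and in both cases m_j = m_(j-2). *)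
Require Import Defs.
From HB Require Import structures.
From mathcomp Require Import all_boot all_order all_algebra.
From mathcomp Require Import all_classical all_reals all_analysis.
From mathcomp Require Import ring lra zify.
Set Implicit Arguments. Unset Strict Implicit. Unset Printing Implicit Defensive.
Import Order.TTheory GRing.Theory Num.Theory.
Import numFieldNormedType.Exports.
Local Open Scope classical_set_scope.
Local Open Scope ring_scope.

(** * Squared norms and affine dependencies *)

Lemma sqnormN (R : realType) (N : nat) (v : 'rV[R]_N) : sqnorm (- v) = sqnorm v.
Proof. by apply: eq_bigr => i _; rewrite mxE sqrrN. Qed.

Lemma sqnorm_gt0 (R : realType) (N : nat) (v : 'rV[R]_N) : (0 < sqnorm v) = (v != 0).
Proof.
have s0 : 0 <= sqnorm v by apply: sumr_ge0 => i _; exact: sqr_ge0.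
rewrite lt0r s0 andbT; congr (~~ _); apply/eqP/eqP => [/eqP|->]; last first.
  by rewrite /sqnorm big1// => i _; rewrite mxE expr0n.
rewrite psumr_eq0 => [|i _]; last exact: sqr_ge0.
move/allP => v0; apply/rowP => i; rewrite mxE; apply/eqP.
by rewrite -sqrf_eq0; exact: v0 (mem_index_enum i).
Qed.

(** Differences to [x ord0] are taken so that the matrix of [span_dim] reappears; on rows of sum 0
    they give the same relation as the positions themselves. *)
Definition affdep (R : realType) (N n : nat) (x : 'I_n.+1 -> 'rV[R]_N) : 'M[R]_n.+1 :=
  (kermx (\matrix_j (x j - x ord0)) :&: kermx (const_mx 1 : 'cV_n.+1))%MS.

Lemma affdepP (R : realType) (N n : nat) (x : 'I_n.+1 -> 'rV[R]_N) (u : 'rV_n.+1) :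
  reflect (\sum_j u 0 j = 0 /\ \sum_j u 0 j *: x j = 0) (u <= affdep x)%MS.
Proof.
have s1 : (u *m (const_mx 1 : 'cV_n.+1) == 0) = (\sum_j u 0 j == 0).
  have e : (u *m (const_mx 1 : 'cV_n.+1)) 0 0 = \sum_j u 0 j.
    by rewrite mxE; apply: eq_bigr => j _; rewrite mxE mulr1.
  by apply/eqP/eqP => [s0|u0]; [rewrite -e s0 mxE|apply/rowP => j; rewrite ord1 e u0 mxE].
have s2 : u *m (\matrix_j (x j - x ord0)) = \sum_j u 0 j *: x j - (\sum_j u 0 j) *: x ord0.
  rewrite mulmx_sum_row scaler_suml -sumrB; apply: eq_bigr => j _.
  by rewrite rowK scalerBr.
rewrite sub_capmx !sub_kermx s1 s2.
apply: (iffP andP) => [[/eqP e /eqP u0]|[u0 ->]].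
  by split => //; move: e; rewrite u0 scale0r subr0.
by rewrite u0 scale0r subr0 !eqxx.
Qed.

(** The kernel of the difference matrix also contains the unit row [e] at index 0, whose entries sum
    to 1. It is therefore independent of [affdep x], which costs one more dimension. *)
Lemma rank_affdep (R : realType) (N n : nat) (x : 'I_n.+1 -> 'rV[R]_N) :
  (\rank (affdep x) + span_dim x <= n)%N.
Proof.
pose e : 'rV[R]_n.+1 := delta_mx 0 0.
have eK : (e <= kermx (\matrix_j (x j - x ord0)))%MS.
  by rewrite sub_kermx -rowE rowK subrr.
have dis : (affdep x :&: e = 0)%MS.
  apply/eqP; rewrite -submx0; apply/rV_subP => v; rewrite sub_capmx => /andP[/affdepP[v0 _]].
  case/sub_rVP => a va; move: v0; rewrite va (bigD1 ord0)//= big1 => [|j j0].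
    by rewrite !mxE mulr1 addr0 => ->; rewrite scale0r sub0mx.
  by rewrite !mxE (negPf j0) mulr0.
have := @mxrankS _ _ _ _ (affdep x + e)%MS (kermx (\matrix_j (x j - x ord0))).
rewrite addsmx_sub eK capmxSl => /(_ isT).
rewrite (mxrank_disjoint_sum dis) mxrank_delta mxrank_ker /=.
have := rank_leq_row (\matrix_j (x j - x ord0)).
by rewrite /=; lia.
Qed.

(** * Squared distances weighted by a dependency, and regular simplices *)

Lemma sum_weighted_sqdist (R : realType) (N n : nat) (x : 'I_n -> 'rV[R]_N) (u : 'I_n -> R) :
  \sum_j u j = 0 -> \sum_j u j *: x j = 0 ->
  \sum_j \sum_l u j * u l * sqnorm (x j - x l) = 0.
Proof.
move=> u0 ux0.
under eq_bigr => j _ do under eq_bigr => l _ do rewrite mulr_sumr.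
under eq_bigr => j _ do rewrite exchange_big.
rewrite exchange_big big1//= => i _.
have a0 : \sum_l u l * x l ord0 i = 0.
  have := congr1 (fun v : 'rV_N => v ord0 i) ux0.
  rewrite /= summxE [RHS]mxE => e; rewrite -[RHS]e.
  by apply: eq_bigr => l _; rewrite mxE.
pose Q := \sum_l u l * x l ord0 i ^+ 2.
(* After expanding the square, each of the three parts contains [\sum_l u l] or
   [\sum_l u l * x l ord0 i] as a factor once summed, and both are 0. *)
under eq_bigr => j _.
  under eq_bigr => l _.
    have -> : u j * u l * (x j - x l) ord0 i ^+ 2 = (u j * x j ord0 i ^+ 2) * u l
      + (- 2 * u j * x j ord0 i) * (u l * x l ord0 i) + u j * (u l * x l ord0 i ^+ 2).
      by rewrite !mxE; ring.
    over.
  rewrite !big_split /= -!mulr_sumr u0 a0 !mulr0 !add0r.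
  over.
by rewrite -mulr_suml u0 mul0r.
Qed.

(** By symmetry of the distance [la] is constant on the support of [u], so all distances there have
    one squared value [rho]. The weighted sum of squared distances is then
    [- rho * \sum_j u j ^+ 2], yet it is 0. *)
Lemma simplex_dependency0 (R : realType) (N n : nat) (f : R -> R)
    (x : 'I_n -> 'rV[R]_N) (u la : 'I_n -> R) :
  (forall r s, 0 < r -> 0 < s -> f r = f s -> r = s) ->
  injective x ->
  \sum_j u j = 0 -> \sum_j u j *: x j = 0 ->
  (forall j l, j != l -> u j != 0 -> u l != 0 -> f (sqnorm (x j - x l)) = la l) ->
  forall j, u j = 0.
Proof.
move=> finj xinj u0 ux0 hla j0; apply/eqP; apply/negPn/negP => uj0.
have dC j l : sqnorm (x j - x l) = sqnorm (x l - x j) by rewrite -sqnormN opprB.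
have d0 j l : j != l -> 0 < sqnorm (x j - x l).
  by move=> jl; rewrite sqnorm_gt0 subr_eq0; apply: contra_neq jl => /xinj.
have lac l : u l != 0 -> la l = la j0.
  move=> ul; have [->//|lj] := eqVneq l j0.
  by rewrite -(hla _ _ lj)// dC (hla j0)// eq_sym.
case: (pickP [pred k | (k != j0) && (u k != 0)]) => [k /andP[kj uk]|none]; last first.
  move/negP: uj0; apply; apply/eqP; rewrite -u0 (bigD1 j0)//= big1 ?addr0// => k kj.
  by apply/eqP; move: (none k); rewrite /= kj /= => /negbFE.
pose rho := sqnorm (x k - x j0).
have drho j l : j != l -> u j != 0 -> u l != 0 -> sqnorm (x j - x l) = rho.
  move=> jl uj ul; apply: finj; rewrite ?d0//.
  by rewrite (hla _ _ jl)// lac// (hla _ _ kj).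
have : \sum_j \sum_l u j * u l * sqnorm (x j - x l) = - rho * \sum_j u j ^+ 2.
  rewrite mulr_sumr; apply: eq_bigr => j _.
  (* The indicator removes the diagonal term, where the distance is 0 and not [rho]. *)
  transitivity (\sum_l u j * rho * (u l - u l * (l == j)%:R)).
    apply: eq_bigr => l _; have [->|jl] := eqVneq l j.
      by rewrite subrr /sqnorm big1 ?mulr0 ?mulr1 ?subrr ?mulr0// => i _; rewrite mxE expr0n.
    rewrite mulr0 subr0.
    have [->|uj] := eqVneq (u j) 0; first by rewrite !mul0r.
    have [->|ul] := eqVneq (u l) 0; first by rewrite mulr0 mul0r mulr0.
    by rewrite drho// 1?eq_sym//; ring.
  rewrite -mulr_sumr sumrB u0 (bigD1 j)//= eqxx big1 => [|l /negPf->]; last by rewrite mulr0.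
  by rewrite mulr1; ring.
rewrite sum_weighted_sqdist// => /esym/eqP; rewrite mulf_eq0 oppr_eq0 gt_eqF ?d0//=.
rewrite psumr_eq0 => [/allP/(_ j0 (mem_index_enum _))|i _]; last exact: sqr_ge0.
by rewrite /= sqrf_eq0 (negPf uj0).
Qed.

(** * Balanced weights *)

(** These are the properties of a difference of two weight vectors that have the same total, the
    same weighted centre and exert the same forces. *)
Definition balanced (R : realType) (N n : nat) (f : R -> R) (x : 'I_n -> 'rV[R]_N)
    (u : 'rV[R]_n) : Prop :=
  [/\ \sum_j u 0 j = 0, \sum_j u 0 j *: x j = 0 &
      forall l, \sum_(j | j != l) (u 0 j * f (sqnorm (x j - x l))) *: (x j - x l) = 0].

Lemma balancedD (R : realType) (N n : nat) (f : R -> R) (x : 'I_n -> 'rV[R]_N) u v a :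
  balanced f x u -> balanced f x v -> balanced f x (u + a *: v).
Proof.
move=> [u1 u2 u3] [v1 v2 v3]; split => [||l].
- by under eq_bigr do rewrite !mxE; rewrite big_split/= -mulr_sumr u1 v1 mulr0 addr0.
- under eq_bigr do rewrite !mxE scalerDl -scalerA.
  by rewrite big_split/= -scaler_sumr u2 v2 scaler0 addr0.
- under eq_bigr do rewrite !mxE mulrDl -mulrA scalerDl -[in X in _ + X]scalerA.
  by rewrite big_split/= -scaler_sumr u3 v3 scaler0 addr0.
Qed.

Definition force_row (R : realType) (N n : nat) (f : R -> R) (x : 'I_n -> 'rV[R]_N)
    (l : 'I_n) (u : 'rV[R]_n) : 'rV[R]_n :=
  \row_j (if j == l then - \sum_(k | k != l) u 0 k * f (sqnorm (x k - x l))
          else u 0 j * f (sqnorm (x j - x l))).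

(** The entry at [l] makes the row sum to 0. Positions may then be measured from [x l], which turns
    the weighted sum of positions into the net force on body [l]. *)
Lemma force_row_affdep (R : realType) (N n : nat) (f : R -> R)
    (x : 'I_n.+1 -> 'rV[R]_N) l u :
  balanced f x u -> (force_row f x l u <= affdep x)%MS.
Proof.
case=> _ _ /(_ l) ul; apply/affdepP.
have e j : j != l -> force_row f x l u 0 j = u 0 j * f (sqnorm (x j - x l)).
  by rewrite mxE => /negPf->.
have el : force_row f x l u 0 l = - \sum_(k | k != l) u 0 k * f (sqnorm (x k - x l)).
  by rewrite mxE eqxx.
rewrite !(bigD1 (P := xpredT) l)//= el (eq_bigr _ e) addNr; split=> //.
under [X in _ + X]eq_bigr => j jl do rewrite e//.
rewrite scaleNr scaler_suml addrC -sumrB -[RHS]ul.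
by apply: eq_bigr => j _; rewrite scalerBr.
Qed.

Lemma balanced_eigen0 (R : realType) (N n : nat) (f : R -> R) (x : 'I_n -> 'rV[R]_N) u :
  (forall r s, 0 < r -> 0 < s -> f r = f s -> r = s) -> injective x ->
  balanced f x u ->
  (forall l, u 0 l != 0 -> exists a, force_row f x l u = a *: u) -> u = 0.
Proof.
move=> finj xinj [u1 u2 u3] eigen; apply/rowP => j; rewrite [RHS]mxE.
have /choice[la hla] : forall l, exists a, u 0 l != 0 -> force_row f x l u = a *: u.
  move=> l; have [ul|_] := boolP (u 0 l != 0); last by exists 0.
  by have [a ha] := eigen l ul; exists a.
apply: (simplex_dependency0 (u := u 0) (la := la) finj xinj u1 u2) => {}j l jl uj ul.
(* Column [j] of the eigenrelation, divided by [u 0 j], shows that [f] of the squared distance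
   depends on [l] only. *)
have := congr1 (fun v : 'rV_n => v 0 j) (hla l ul); rewrite /= !mxE (negPf jl).
by rewrite mulrC => /(mulIf uj).
Qed.

Lemma balanced0_dim1 (R : realType) (N n : nat) (f : R -> R) (x : 'I_n.+1 -> 'rV[R]_N) u :
  (forall r s, 0 < r -> 0 < s -> f r = f s -> r = s) -> injective x ->
  (\rank (affdep x) <= 1)%N -> balanced f x u -> u = 0.
Proof.
move=> finj xinj rk bu; apply: (balanced_eigen0 finj xinj bu) => l ul.
have uD : (u <= affdep x)%MS by case: bu => u1 u2 _; apply/affdepP.
apply/sub_rVP; apply: (submx_trans (force_row_affdep l bu)).
rewrite -(geq_leqif (mxrank_leqif_sup uD)) (leq_trans rk)// rank_rV.
by rewrite lt0b; apply: contraNneq ul => ->; rewrite mxE.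
Qed.

(* The rows [force_row f x l u], for [l] in the support of [u], vanish at [j0] together with [u]; the affine dependencies vanishing at [j0] form a line because [v] does not vanish there. *)
Lemma balanced0_dim2 (R : realType) (N n : nat) (f : R -> R) (x : 'I_n.+1 -> 'rV[R]_N)
    u v j0 :
  (forall r s, 0 < r -> 0 < s -> f r = f s -> r = s) -> injective x ->
  (\rank (affdep x) <= 2)%N -> balanced f x u -> balanced f x v ->
  u 0 j0 = 0 -> v 0 j0 != 0 -> u = 0.
Proof.
move=> finj xinj rk bu bv uj vj; apply: (balanced_eigen0 finj xinj bu) => l ul.
have bD w : balanced f x w -> (w <= affdep x)%MS.
  by case=> w1 w2 _; apply/affdepP.
have vuD : (v + u <= affdep x)%MS by rewrite addsmx_sub !bD.
have dis : (v :&: u = 0)%MS.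
  apply/eqP; rewrite -submx0; apply/rV_subP => w; rewrite sub_capmx => /andP[].
  case/sub_rVP => a -> /sub_rVP[b /(congr1 (fun z : 'rV_n.+1 => z 0 j0))].
  rewrite /= !mxE uj mulr0 => /eqP; rewrite mulf_eq0 (negPf vj) orbF => /eqP->.
  by rewrite scale0r sub0mx.
have : (force_row f x l u <= v + u)%MS.
  apply: (submx_trans (force_row_affdep l bu)).
  rewrite -(geq_leqif (mxrank_leqif_sup vuD)) (leq_trans rk)//.
  rewrite (mxrank_disjoint_sum dis) !rank_rV.
  have -> : v != 0 by apply: contraNneq vj => ->; rewrite mxE.
  by have -> : u != 0 by apply: contraNneq ul => ->; rewrite mxE.
case/sub_addsmxP => -[a b] /= eab.
exists (b 0 0); rewrite eab [a]mx11_scalar [b]mx11_scalar !mul_scalar_mx !mxE/=.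
have : force_row f x l u 0 j0 = 0.
  by rewrite mxE uj mul0r ifN//; apply: contraNneq ul => <-; rewrite uj.
rewrite eab [a]mx11_scalar [b]mx11_scalar !mul_scalar_mx !mxE/= uj mulr0 addr0 => /eqP.
by rewrite !mulr1n mulf_eq0 (negPf vj) orbF => /eqP->; rewrite scale0r add0r.
Qed.

(** * Time shifts, and periodic functions with zero second derivative *)

Lemma derive1_shift (R : realType) (V : normedModType R) (g : R -> V) (a : R) :
  derive1 (fun t => g (t + a)) = fun t => derive1 g (t + a).
Proof.
by apply/funext => t; rewrite /derive1; under eq_fun do rewrite -addrA.
Qed.

Lemma derivable_shift (R : realType) (V : normedModType R) (g : R -> V) (a : R) :
  (forall t, derivable g t 1) -> forall t, derivable (fun t => g (t + a)) t 1.
Proof.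
move=> dg t; have := dg (t + a); rewrite /derivable /=.
by under eq_fun do rewrite addrA.
Qed.

Lemma derive1_lincomb (R : realType) (V : normedModType R) (n : nat) (a : 'I_n -> R)
    (g : 'I_n -> R -> V) :
  (forall i t, derivable (g i) t 1) ->
  (forall t, derivable (fun t => \sum_i a i *: g i t) t 1) /\
  derive1 (fun t => \sum_i a i *: g i t) = fun t => \sum_i a i *: derive1 (g i) t.
Proof.
move=> dg.
have -> : (fun t => \sum_i a i *: g i t) = \sum_i (a i \*: g i).
  by apply/funext => t; rewrite fct_sumE.
have dag i t : derivable (a i \*: g i) t 1 by apply: derivableZ.
split=> [t|]; first exact: derivable_sum.
apply/funext => t; rewrite derive1E derive_sum//.
by apply: eq_bigr => i _; rewrite deriveZ// derive1E.
Qed.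

Lemma periodic_derive2_0_cst (R : realType) (g : R -> R) (P : R) :
  0 < P -> (forall t, g (t + P) = g t) ->
  (forall t, derivable g t 1) -> (forall t, derivable (derive1 g) t 1) ->
  (forall t, derive1 (derive1 g) t = 0) -> forall s t, g s = g t.
Proof.
move=> P0 gP dg ddg g2.
have cst (k : R -> R) : (forall t, derivable k t 1) -> (forall t, derive1 k t = 0) ->
    forall s t, k s = k t.
  move=> dk k0 s t; apply: is_derive_0_is_cst => u.
  by apply: DeriveDef => //; rewrite -derive1E k0.
have g1 := cst _ ddg g2.
(* The derivative is the constant [c], so [g] is affine of slope [c]; comparing the times 0 and [P]
   gives [c * P = 0]. *)
pose c : R := derive1 g 0.
have k1 (t : R) : is_derive t (1 : R) (g - c \*: (@id R : R -> R)) 0.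
  have -> : (0 : R) = c - c *: 1 by rewrite scaler1 subrr.
  by apply: is_deriveB; apply: DeriveDef => //; rewrite -derive1E; exact: g1.
have k2 := is_derive_0_is_cst _ _ k1.
have c0 : c = 0.
  have : g P - c * P = g 0 - c * 0 := k2 P 0.
  have -> : g P = g 0 by rewrite -[P]add0r gP.
  by move=> /addrI/oppr_inj/eqP; rewrite mulr0 mulf_eq0 (gt_eqF P0) orbF => /eqP.
move=> s t; have : g s - c * s = g t - c * t := k2 s t.
by rewrite c0 !mul0r !subr0.
Qed.

Lemma periodic_rV_derive2_0_cst (R : realType) (N : nat) (G : R -> 'rV[R]_N) (P : R) :
  0 < P -> (forall t, G (t + P) = G t) ->
  (forall t, derivable G t 1) -> (forall t, derivable (derive1 G) t 1) ->
  (forall t, derive1 (derive1 G) t = 0) -> forall s t, G s = G t.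
Proof.
move=> P0 GP dG ddG G2 s t; apply/rowP => i.
have coord (H : R -> 'rV[R]_N) : (forall t, derivable H t 1) ->
    (forall t, derivable (fun t => H t 0 i) t 1) /\
    derive1 (fun t => H t 0 i) = fun t => derive1 H t 0 i.
  move=> dH; split=> [u|]; first by have /derivable_mxP := dH u.
  by apply/funext => u; rewrite !derive1E derive_mx// mxE.
have [d1 e1] := coord _ dG; have [d2 e2] := coord _ ddG.
apply: (periodic_derive2_0_cst (g := fun t => G t 0 i) P0) => // u.
- by rewrite GP.
- by rewrite e1.
- by rewrite e1 e2 G2 mxE.
Qed.

(** * Equations of motion under cyclic relabelling *)

Definition solves (R : realType) (N n : nat) (f : R -> R) (q : 'I_n -> R -> 'rV[R]_N)
    (nu : 'I_n -> R) : Prop :=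
  forall k t, derive1 (derive1 (q k)) t =
    \sum_(j | j != k) (nu j * f (sqnorm (q j t - q k t))) *: (q j t - q k t).

Definition fixed_center (R : realType) (N n : nat) (q : 'I_n -> R -> 'rV[R]_N)
    (nu : 'I_n -> R) (C : 'rV[R]_N) : Prop :=
  forall t, \sum_j nu j *: q j t = C.

(** Waiting for time [tau] puts each body where its successor was, so the equation of body [l] at
    [t + tau] is one for [ordS l] at [t], with every weight moved on by one label. *)
Lemma solves_shift (R : realType) (N n : nat) (f : R -> R) (q : 'I_n -> R -> 'rV[R]_N) tau nu :
  (forall k t, q (ordS k) t = q k (t + tau)) ->
  solves f q nu -> solves f q (nu \o @ord_pred n).
Proof.
move=> qS sol k t; rewrite -[k]ord_predK; set l := ord_pred k.
have -> : q (ordS l) = fun t => q l (t + tau) by apply/funext => s; exact: qS.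
rewrite !derive1_shift sol [RHS](reindex _ (onW_bij _ (@ordS_bij n))).
apply: eq_big => [j|j _]; first by rewrite (inj_eq (@ordS_inj n)).
by rewrite /= ordSK !qS.
Qed.

Lemma fixed_center_shift (R : realType) (N n : nat) (q : 'I_n -> R -> 'rV[R]_N) tau nu C :
  (forall k t, q (ordS k) t = q k (t + tau)) ->
  fixed_center q nu C -> fixed_center q (nu \o @ord_pred n) C.
Proof.
move=> qS cen t; rewrite -(cen (t + tau)) [LHS](reindex _ (onW_bij _ (@ordS_bij n))).
by apply: eq_bigr => j _; rewrite /= ordSK qS.
Qed.

Lemma total_force0 (R : realType) (N n : nat) (f : R -> R) (x : 'I_n -> 'rV[R]_N)
    (nu : 'I_n -> R) :
  \sum_k nu k *: (\sum_(j | j != k) (nu j * f (sqnorm (x j - x k))) *: (x j - x k)) = 0.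
Proof.
pose T k j := (nu k * nu j * f (sqnorm (x j - x k))) *: (x j - x k).
have TN k j : T j k = - T k j.
  by rewrite /T -scalerN opprB -(sqnormN (x k - x j)) opprB [nu j * _]mulrC.
have -> : \sum_k nu k *: (\sum_(j | j != k) (nu j * f (sqnorm (x j - x k))) *: (x j - x k))
    = \sum_k \sum_j T k j.
  apply: eq_bigr => k _; rewrite [RHS](bigD1 k)//= {1}/T subrr scaler0 add0r scaler_sumr.
  by apply: eq_bigr => j _; rewrite scalerA mulrA.
(* Action and reaction: exchanging the two indices changes the sign of every term. *)
set S := LHS; have : S = - S.
  rewrite {1}/S exchange_big -sumrN; apply: eq_bigr => k _.
  by rewrite -sumrN; apply: eq_bigr => j _; exact: TN.
by move/eqP; rewrite -addr_eq0 -mulr2n -scaler_nat scaler_eq0 pnatr_eq0 /= => /eqP.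
Qed.

Lemma solves_fixed_center (R : realType) (N n : nat) (f : R -> R)
    (q : 'I_n -> R -> 'rV[R]_N) nu P :
  0 < P -> (forall k t, q k (t + P) = q k t) ->
  (forall k t, derivable (q k) t 1) -> (forall k t, derivable (derive1 (q k)) t 1) ->
  solves f q nu -> exists C, fixed_center q nu C.
Proof.
move=> P0 qP dq ddq sol; exists (\sum_j nu j *: q j 0) => t.
have [d1 e1] := derive1_lincomb nu dq; have [d2 e2] := derive1_lincomb nu ddq.
apply: (periodic_rV_derive2_0_cst P0 _ d1) => [s|s|s].
- by apply: eq_bigr => j _; rewrite qP.
- by rewrite e1.
- by rewrite e1 e2; under eq_bigr do rewrite sol; exact: total_force0.
Qed.

Lemma balanced_shift_diff (R : realType) (N n : nat) (f : R -> R)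
    (q : 'I_n -> R -> 'rV[R]_N) tau nu C t :
  (forall k t, q (ordS k) t = q k (t + tau)) ->
  solves f q nu -> fixed_center q nu C ->
  balanced f (fun j => q j t) (\row_j (nu j - nu (ord_pred j))).
Proof.
move=> qS sol cen; split=> [||l].
- under eq_bigr do rewrite mxE; rewrite sumrB.
  by rewrite [X in _ - X](reindex _ (onW_bij _ (@ordS_bij n)));
    under [X in _ - X]eq_bigr do rewrite ordSK; rewrite subrr.
- under eq_bigr do rewrite mxE scalerBl; rewrite sumrB cen.
  by rewrite (fixed_center_shift qS cen) subrr.
- under eq_bigr do rewrite mxE mulrBl scalerBl; rewrite sumrB -sol.
  by rewrite -(solves_shift qS sol) subrr.
Qed.

(** * Cyclic symmetries of the masses *)

Lemma shift_invariant_cst (T : Type) (n : nat) (m : 'I_n -> T) :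
  (forall j, m j = m (ord_pred j)) -> forall i j, m i = m j.
Proof.
move=> mP; suff H k (i j : 'I_n) : i = k :> nat -> j = 0 :> nat -> m i = m j.
  move=> i j; have n0 : (0 < n)%N by apply: leq_ltn_trans (ltn_ord i).
  by rewrite (H i _ (Ordinal n0))// (H j j (Ordinal n0)).
elim: k i => [|k IH] i ik j0; first by congr m; apply/val_inj; rewrite /= ik.
rewrite mP; apply: IH => //=; rewrite ik addSn /= modnDr modn_small//.
by rewrite ltnW// -ik.
Qed.

Lemma shift2_invariant_parity (T : Type) (n : nat) (m : 'I_n -> T) :
  (forall j, m j = m (ord_pred (ord_pred j))) ->
  forall i j : 'I_n, odd i = odd j -> m i = m j.
Proof.
(* Descending in steps of 2 takes every label to 0 or 1, which is [odd i] read as a number. *)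
move=> mP; suff H k (i j : 'I_n) : (i < k)%N -> j = odd i :> nat -> m i = m j.
  move=> i j ij; have in2 : (odd i < n)%N.
    by have := ltn_ord i; case: (nat_of_ord i) => [|k]//=; case: (odd k) => //=; lia.
  by rewrite (H i.+1 i (Ordinal in2))// (H j.+1 j (Ordinal in2))//= ij.
elim: k i => // k IH i ik jE.
have [i2|i2] := ltnP i 2.
  by congr m; apply/val_inj; rewrite /= jE; case: (nat_of_ord i) i2 => [|[|]].
have pE (l : 'I_n) : (0 < l)%N -> ord_pred l = l.-1 :> nat.
  move=> l0 /=; have := ltn_ord l; case: (nat_of_ord l) l0 => //= a _ an.
  by rewrite modnDr modn_small// ltnW.
have ppE : ord_pred (ord_pred i) = i.-2 :> nat by rewrite !pE//; lia.
rewrite mP; apply: IH; rewrite ppE; first lia.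
by rewrite jE; case: (nat_of_ord i) i2 => [|[|a]]//= _; rewrite negbK.
Qed.

Lemma shift2_invariant_odd (T : Type) (n : nat) (m : 'I_n -> T) :
  odd n -> (forall j, m j = m (ord_pred (ord_pred j))) -> forall i j, m i = m j.
Proof.
case: n m => [|[|n]]// m on mP; first by move=> i j; rewrite !ord1.
have par := shift2_invariant_parity mP.
(* Two steps back from label 0 wrap around to label [n], which is odd here, and this joins the two
   parity classes. *)
have m01 : m ord0 = m (inord 1).
  have E : ord_pred (ord_pred (ord0 : 'I_n.+2)) = n :> nat.
    by rewrite /= (modn_small (ltnSn n.+1)) addSn /= modnDr modn_small.
  by rewrite mP; apply: par; rewrite E inordK//=; move: on; rewrite /= negbK.
suff H i : m i = m ord0 by move=> i j; rewrite !H.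
case oi : (odd i); last exact: par.
by rewrite m01; apply: par; rewrite inordK.
Qed.

Lemma mass_shift2_invariant (R : realType) (N n : nat) (f : R -> R)
    (x : 'I_n.+1 -> 'rV[R]_N) (m : 'I_n.+1 -> R) :
  (forall r s, 0 < r -> 0 < s -> f r = f s -> r = s) -> injective x ->
  (\rank (affdep x) <= 2)%N ->
  balanced f x (\row_j (m j - m (ord_pred j))) ->
  balanced f x (\row_j (m (ord_pred j) - m (ord_pred (ord_pred j)))) ->
  forall j, m j = m (ord_pred (ord_pred j)).
Proof.
move=> finj xinj rk; set v := \row_j _; set w := \row_j _ => bv bw.
have wE j : w 0 j = v 0 (ord_pred j) by rewrite !mxE.
suff [c c1 wc] : exists2 c : R, c = 1 \/ c = -1 & forall j, w 0 j = c * v 0 j.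
  (* For [c = -1] the relation is the claim itself. For [c = 1], [v] is constant with sum 0, hence
     zero. *)
  have [c1'|c1'] := c1; last first.
    by move=> j; have := wc j; rewrite c1' !mxE; lra.
  have vcst j : v 0 j = 0.
    have e i : v 0 i = v 0 j.
      by apply: (shift_invariant_cst (m := v 0)) => k; rewrite -wE wc c1' mul1r.
    case: bv => + _ _; under eq_bigr do rewrite e.
    by rewrite sumr_const card_ord => /eqP; rewrite mulrn_eq0 /= => /eqP.
  by move=> j; have := vcst j; have := vcst (ord_pred j); rewrite !mxE; lra.
have [v0|/rV0Pn[j0 vj0]] := eqVneq v 0.
  by exists 1 => [|j]; [left|rewrite wE v0 !mxE mulr0].
clearbody v w.
(* This [c] makes [w - c * v] vanish at [j0], as [balanced0_dim2] requires. *)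
pose c := w 0 j0 / v 0 j0.
have wcv : w + (- c) *: v = 0.
  apply: (balanced0_dim2 (j0 := j0) finj xinj rk _ bv _ vj0); first exact: balancedD.
  by rewrite /c !mxE mulNr divfK ?subrr.
have wc j : w 0 j = c * v 0 j.
  have := congr1 (fun z : 'rV_n.+1 => z 0 j) wcv.
  by rewrite !mxE => /eqP; rewrite mulNr subr_eq0 => /eqP.
exists c => //.
have s0 : \sum_j v 0 j ^+ 2 != 0.
  apply: contraNneq vj0 => /eqP; rewrite psumr_eq0 => [/allP/(_ j0 (mem_index_enum _))|i _].
    by rewrite /= sqrf_eq0.
  exact: sqr_ge0.
(* The shift permutes the entries of [v], so it preserves their sum of squares. *)
have : c ^+ 2 * \sum_j v 0 j ^+ 2 = 1 * \sum_j v 0 j ^+ 2.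
  rewrite mul1r [RHS](reindex _ (onW_bij _ (@ord_pred_bij n.+1))) mulr_sumr.
  by apply: eq_bigr => j _; rewrite -wE wc [RHS]exprMn.
by move=> /(mulIf s0)/eqP; rewrite sqrf_eq1 => /orP[]/eqP ce; [left|right].
Qed.

(** * Application to the choreography *)

Lemma dim_is_time (R : realType) (N n : nat) (q : 'I_n -> R -> 'rV[R]_N) (P : R) (k : nat) :
  0 < P -> dim_is q P k -> exists t, span_dim (fun j => q j t) = k.
Proof.
move=> P0 [S [_ _ muS Sk]].
(* A set of measure [P > 0] is not empty, and one instant suffices. *)
have [S0|/set0P[t /Sk]] := eqVneq S set0; last by exists t.
by move: muS; rewrite S0 measure0 => /eqP; rewrite eq_sym eqe gt_eqF.
Qed.

Unset Implicit Arguments. Set Strict Implicit.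

Theorem theorem1 (R : realType) (N n : nat) (m : 'I_n -> R) (f : R -> R)
    (p : R -> 'rV[R]_N) (P : R) (h : nat -> R) (q : 'I_n -> R -> 'rV[R]_N) :
  (2 <= n)%N ->
  (forall k, 0 < m k) ->
  (* f : R_{>0} -> R_{>0}, and sqrt(x) f(x) decreasing on R_{>0} *)
  (forall x, 0 < x -> 0 < f x) ->
  (forall x y, 0 < x -> x < y -> Num.sqrt y * f y < Num.sqrt x * f x) ->
  (* p is C^2 and P-periodic *)
  0 < P ->
  (forall t, p (t + P) = p t) ->
  (forall t, derivable p t 1) ->
  (forall t, derivable (derive1 p) t 1) ->
  continuous (derive1 (derive1 p)) ->
  (* choreography, equally spaced (indices extended by h_{k+n} = h_k + P) *)
  (forall k : 'I_n, forall t, q k t = p (t + h k)) ->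
  (forall k, h (k + n)%N = h k + P) ->
  (exists c, forall k, h k.+1 - h k = c) ->
  (* q is a (collision-free) solution of the equations of motion *)
  (forall t (j k : 'I_n), j != k -> q j t != q k t) ->
  (forall (k : 'I_n) t,
     derive1 (derive1 (q k)) t =
     \sum_(j < n | j != k) (m j * f (sqnorm (q j t - q k t))) *: (q j t - q k t)) ->
  ((dim_is q P (n - 1) \/ dim_is q P (n - 2) \/
     [/\ (3 <= n)%N, odd n & dim_is q P (n - 3)]) ->
     forall i j : 'I_n, m i = m j) /\
  ([/\ (3 <= n)%N, ~~ odd n & dim_is q P (n - 3)] ->
     forall i j : 'I_n, odd i = odd j -> m i = m j).

Proof.
move=> n2 _ fpos fdec P0 pP dp ddp _ qE hP [c hc] qinj sol.
case: n m h q n2 qE hP hc qinj sol => // n m h q n2 qE hP hc qinj sol.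
(* If [f a = f b] with [a < b], cancelling this positive value in the monotonicity hypothesis would
   give [Num.sqrt b < Num.sqrt a]. *)
have finj (r s : R) : 0 < r -> 0 < s -> f r = f s -> r = s.
  have lt (a b : R) : 0 < a -> a < b -> f a <> f b.
    move=> a0 ab fab; have b0 := lt_trans a0 ab.
    have := fdec _ _ a0 ab; rewrite fab => /ltW.
    have b1 : 0 < f b by exact: fpos.
    by rewrite (ler_pM2r b1) leNgt ltr_sqrt// ab.
  by move=> r0 s0 frs; case: (ltgtP r s) => // [/lt|/lt]; [move/(_ r0)|move/(_ s0)]; rewrite frs.
have qS k t : q (ordS k) t = q k (t + c).
  rewrite !qE /=; have -> : t + c + h k = t + h k.+1 by rewrite -(hc k); ring.
  have [kn|] := ltnP k.+1 n.+1; first by rewrite modn_small.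
  (* The last body wraps around to label 0: here [h n.+1 = h 0 + P], and [p] absorbs the period. *)
  rewrite leq_eqVlt ltnNge ltn_ord orbF => /eqP <-.
  by rewrite modnn -[n.+1]add0n hP addrA pP.
have qfE k : q k = fun t => p (t + h k) by apply/funext => t; exact: qE.
have dq k t : derivable (q k) t 1 by rewrite qfE; exact: derivable_shift.
have ddq k t : derivable (derive1 (q k)) t 1.
  by rewrite qfE derive1_shift; exact: derivable_shift.
have qP k t : q k (t + P) = q k t by rewrite !qE addrAC pP.
have [C cen] := solves_fixed_center P0 qP dq ddq sol.
have bal t := balanced_shift_diff t qS sol cen.
have bal' t := balanced_shift_diff t qS (solves_shift qS sol) (fixed_center_shift qS cen).
have xinj t : injective (fun j => q j t).
  by move=> j k e; apply/eqP/negPn/negP => /(qinj t); rewrite e eqxx.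
(* There are now [n.+1] bodies, so dimension [k] leaves at most [n - k] independent dependencies. *)
have rk k : dim_is q P k -> exists t, (\rank (affdep (fun j => q j t)) <= n - k)%N.
  case/(dim_is_time P0) => t tk; exists t.
  by have := rank_affdep (fun j => q j t); rewrite tk; lia.
have eq_mass k : (n <= k.+1)%N -> dim_is q P k -> forall i j, m i = m j.
  move=> nk /rk[t rt]; apply: shift_invariant_cst => j.
  have r1 : (\rank (affdep (fun j => q j t)) <= 1)%N by lia.
  have := congr1 (fun z : 'rV_n.+1 => z 0 j) (balanced0_dim1 finj (xinj t) r1 (bal t)).
  by rewrite !mxE => /eqP; rewrite subr_eq0 => /eqP.
have mass2 k : (n <= k.+2)%N -> dim_is q P k -> forall j, m j = m (ord_pred (ord_pred j)).
  move=> nk /rk[t rt]; apply: (mass_shift2_invariant finj (xinj t) _ (bal t) (bal' t)).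
  by lia.
split=> [[|[|[n3 no]]]|[n3 _]].
- by apply: eq_mass; lia.
- by apply: eq_mass; lia.
- by move/mass2 => H; apply: shift2_invariant_odd => //; apply: H; lia.
- by move/mass2 => H; apply: shift2_invariant_parity; apply: H; lia.
Qed.
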